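(* Let $K=\bigcup_{N\ge1}\mathbb{C}(\!(t^{1/N})\!)$ and let $L\subset K^n$ be a lattice whose $K$-span is not contained in any coordinate hyperplane, with entropy vector $h=(h_J)_{J\subset[n]}$ and polyhedral complex $\Sigma_L$. Then $|\Sigma_L|$ is a tropical semimodule over $\mathbb{R}_{\ge0}$: for all $u,v\in|\Sigma_L|$ and $\lambda\in\mathbb{R}_{\ge0}$, \[\lambda\odot u\in|\Sigma_L|\quad\text{and}\quad u\oplus v\in|\Sigma_L|.\] Moreover, for each $J\subsetneq[n]$ with $h_J\neq\infty$ define $u_J\in(\mathbb{R}\cup\{\infty\})^n$ by $u_{J,j}=h_{J\cup\{j\}}-h_J$ if $j\notin J$ and $u_{J,j}=+\infty$ if $j\in J$. Then \[|\Sigma_L|=\Big\{\bigoplus_{J\subsetneq[n],\,h_J\neq\infty}\lambda_J\odot u_J \ :\ \lambda_J\in\mathbb{R}_{\ge0}\text{ for all } J\subsetneq[n]\text{ with } h_J\neq\infty\Big\}.\]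
   Context: Tropical operations on $\mathbb{R}\cup\{\infty\}$: $x\oplus y=\min(x,y)$, $x\odot y=x+y$; on vectors componentwise, $(x\oplus y)_i=\min(x_i,y_i)$, $(\lambda\odot x)_i=\lambda+x_i$. $K$ is the field of complex Puiseux series with valuation $\mathrm{val}$ (minimum exponent, $\mathrm{val}(0)=\infty$) and valuation ring $\mathcal{O}_K=\{\mathrm{val}\ge0\}$. A lattice $L\subset K^n$ of rank $r$ is the $\mathcal{O}_K$-span of the rows of a full-rank $A\in K^{r\times n}$. Entropy vector: $h_J=\min_{I\subset[r],|I|=|J|}\mathrm{val}(\det A_{I\times J})$, $h_\varnothing=0$, $h_J=\infty$ if $|J|>r$. Entropy polynomial $\varphi_L(v)=\max_{J\subset[n]}(v_J-h_J)$ on $\mathbb{R}^n$ with $v_J=\sum_{j\in J}v_j$, $v_\varnothing=0$ (terms with $h_J=\infty$ are $-\infty$). $\mathcal{K}_L$ is the polyhedral complex of domains of linearity of $\varphi_L$ on $\mathbb{R}^n$: maximal cells are the $n$-dimensional sets $\sigma_J=\{v:\varphi_L(v)=v_J-h_J\}$, cells are these and their faces; labels $\ell(\sigma_J)=J$ on maximal cells and $\ell(\tau)=\bigcup\{\ell(\sigma):\sigma\text{ maximal}, \tau\subseteq\sigma\}$. $\Sigma_L=\{\tau\in\mathcal{K}_L:\ell(\tau)=[n]\}$ and $|\Sigma_L|$ is the union of its cells. *)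

(* Defs.v *)
From HB Require Import structures.
From mathcomp Require Import all_boot all_order all_algebra.
From mathcomp Require Import all_classical all_reals ereal.
From mathcomp Require Import complex.
Set Implicit Arguments.
Unset Strict Implicit.
Unset Printing Implicit Defensive.
Import Order.TTheory GRing.Theory Num.Theory.
Local Open Scope classical_set_scope.
Local Open Scope ring_scope.

Section PowerSeries.
Variable F : fieldType.
Implicit Types a b c : nat -> F.

Definition ps_mul a b : nat -> F := fun n => \sum_(i < n.+1) a i * b (n - i)%N.

Lemma ps_mulE a b n m : (n <= m)%N ->
  ps_mul a b n = (\poly_(i < m.+1) a i * \poly_(i < m.+1) b i)`_n.
Proof.
move=> nm; rewrite coefM; apply: eq_bigr => i _; rewrite !coef_poly.
by rewrite (leq_trans (ltn_ord i)) // (leq_ltn_trans (leq_subr _ _)).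
Qed.

Lemma ps_mulC a b : ps_mul a b = ps_mul b a.
Proof. by apply/funext => n; rewrite !(ps_mulE _ _ (leqnn n)) mulrC. Qed.

Lemma ps_mulA a b c : ps_mul a (ps_mul b c) = ps_mul (ps_mul a b) c.
Proof.
apply/funext => n; set P := fun a => \poly_(i < n.+1) a i : {poly F}.
transitivity ((P a * (P b * P c))`_n); last rewrite mulrA.
  rewrite coefM; apply: eq_bigr => i _.
  rewrite {1}/P coef_poly ltn_ord; congr (_ * _).
  by rewrite (@ps_mulE _ _ _ n) // leq_subr.
rewrite coefM; apply: eq_bigr => i _.
rewrite [(P c)`__]coef_poly ltnS leq_subr; congr (_ * _).
by rewrite (@ps_mulE _ _ _ n) // -ltnS.
Qed.

Lemma ps_mulDl a b c n :
  ps_mul (fun k => a k + b k) c n = ps_mul a c n + ps_mul b c n.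
Proof. by rewrite -big_split; apply: eq_bigr => i _; rewrite mulrDl. Qed.

Definition ps_one : nat -> F := fun n => (n == 0%N)%:R.

Lemma ps_mul1 a : ps_mul ps_one a = a.
Proof.
apply/funext => n; rewrite /ps_mul big_ord_recl subn0 /ps_one eqxx mul1r.
by rewrite big1 ?addr0 // => i _; rewrite mul0r.
Qed.

Fixpoint ps_inv_seq a n : seq F :=
  if n is n'.+1 then
    let s := ps_inv_seq a n' in
    rcons s (if n' is 0 then (a 0)^-1
             else - (a 0)^-1 * \sum_(k < n') a (n' - k)%N * s`_k)
  else [::].

Lemma ps_inv_seq_size a n : size (ps_inv_seq a n) = n.
Proof. by elim: n => //= n IH; rewrite size_rcons IH. Qed.

Lemma ps_inv_seq_nth a n k : (k < n)%N ->
  (ps_inv_seq a n)`_k = (ps_inv_seq a k.+1)`_k.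
Proof.
elim: n => // n IH; rewrite ltnS leq_eqVlt => /orP[/eqP -> //|kn].
by rewrite [LHS]/= nth_rcons ps_inv_seq_size kn IH.
Qed.

Definition ps_inv a : nat -> F := fun n => (ps_inv_seq a n.+1)`_n.

Lemma ps_invP a : a 0 != 0 -> ps_mul (ps_inv a) a = ps_one.
Proof.
move=> a0; apply/funext => -[|n].
  by rewrite /ps_mul big_ord1 subnn /= mulVf.
rewrite /ps_mul big_ord_recr /= subnn {2}/ps_inv.
rewrite [ps_inv_seq a _.+2]/= -/(ps_inv_seq a n.+1).
rewrite nth_rcons ps_inv_seq_size ltnn eqxx mulrAC mulNr mulVf // mulN1r.
apply/eqP; rewrite subr_eq0; apply/eqP; apply: eq_bigr => i _.
by rewrite mulrC /ps_inv -(ps_inv_seq_nth a (ltn_ord i)).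
Qed.

End PowerSeries.

Section Puiseux.
Variable F : fieldType.
Implicit Types f g h : rat -> F.

(* Coefficient functions of the elements of the union over N >= 1 of the
   Laurent series fields F((t^(1/N))): f q is the coefficient of t^q. *)
Definition is_puiseux f : Prop :=
  exists (N : nat) (m : int), (0 < N)%N /\
    forall q, f q != 0 -> exists2 k : int, m <= k & q = k%:~R / N%:R.

Definition puiseux_pred : {pred rat -> F} := fun f => `[< is_puiseux f >].

(* Cauchy product; the sum has finitely many nonzero terms when f and g are
   Puiseux series. *)
Definition puiseux_conv f g : rat -> F :=
  fun q => \sum_(s \in [set: rat]) f s * g (q - s).

Definition puiseux_delta : rat -> F := fun q => (q == 0)%:R.

Let ex (N : nat) (m : int) (k : nat) : rat := (m + k%:Z)%:~R / N%:R.

Let lau (N : nat) (m : int) (a : nat -> F) : rat -> F := fun q =>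
  let z := q * N%:R - m%:~R in if z \is a Num.nat then a (Num.trunc z) else 0.

Let exK N m k : (0 < N)%N -> ex N m k * N%:R - m%:~R = k%:R.
Proof.
move=> N0; rewrite /ex divfK ?pnatr_eq0 -?lt0n // intrD addrAC subrr add0r.
by rewrite pmulrn.
Qed.

Let lau_ex N m a k : (0 < N)%N -> lau N m a (ex N m k) = a k.
Proof. by move=> N0; rewrite /lau exK // natr_nat natrK. Qed.

Let lau_out N m a q : (0 < N)%N -> (forall k, q <> ex N m k) -> lau N m a q = 0.
Proof.
move=> N0 H; rewrite /lau; case: ifP => // /natrP[k Hk]; case: (H k).
rewrite /ex intrD -pmulrn -Hk addrCA subrr addr0 mulfK //.
by rewrite pnatr_eq0 -lt0n.
Qed.

Let exP N m q : (exists k, q = ex N m k) \/ (forall k, q <> ex N m k).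
Proof.
have [|H] := pselect (exists k, q = ex N m k); first by left.
by right=> k qk; apply: H; exists k.
Qed.

Let ex_inj N m : (0 < N)%N -> injective (ex N m).
Proof.
move=> N0 i j /(congr1 (fun x => x * N%:R - m%:~R)); rewrite !exK //.
by move/eqP; rewrite eqr_nat => /eqP.
Qed.

Let lau_puiseux N m a : (0 < N)%N -> is_puiseux (lau N m a).
Proof.
move=> N0; exists N, m; split=> // q.
have [[k ->] _|H] := exP N m q; last by rewrite lau_out ?eqxx.
by exists (m + k%:Z) => //; rewrite lerDl.
Qed.

Let supp N m f := forall q, f q != 0 -> exists k, q = ex N m k.

Let lau_of N m f : (0 < N)%N -> supp N m f -> f = lau N m (fun k => f (ex N m k)).
Proof.
move=> N0 H; apply/funext => q; have [[k ->]|Hq] := exP N m q.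
  by rewrite lau_ex.
rewrite lau_out //; apply/eqP; apply: contrapT => /negP /H [k].
exact: Hq.
Qed.

Let puiseux_supp f : is_puiseux f -> exists N m, (0 < N)%N /\ supp N m f.
Proof.
move=> [N [m [N0 H]]]; exists N, m; split=> // q /H [k mk ->].
exists `|k - m|%N; rewrite /ex; congr (_%:~R / _).
by rewrite gez0_abs ?subr_ge0 // [RHS]addrC subrK.
Qed.

(* passing to a larger denominator and a smaller lower bound *)
Let suppW N (m : int) f M (p : int) : (0 < N)%N -> (0 < M)%N -> p <= m * M%:Z ->
  supp N m f -> supp (N * M) p f.
Proof.
move=> N0 M0 pm H q /H [k ->].
exists (absz ((m + k%:Z) * M%:Z - p)%R); rewrite /ex gez0_abs; last first.
  rewrite subr_ge0 (le_trans pm) // ler_wpM2r // lerDl //.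
rewrite [p + _]addrC subrK intrM natrM -pmulrn invfM mulrACA.
by rewrite divff ?mulr1 // pnatr_eq0 -lt0n.
Qed.

Let supp2 f g : is_puiseux f -> is_puiseux g ->
  exists N m, [/\ (0 < N)%N, supp N m f & supp N m g].
Proof.
move=> /puiseux_supp[N [m [N0 Hf]]] /puiseux_supp[M [p [M0 Hg]]].
exists (N * M)%N, (Num.min (m * M%:Z) (p * N%:Z)); split.
- by rewrite muln_gt0 N0.
- by apply: suppW Hf => //; rewrite ge_min lexx.
- by rewrite mulnC; apply: suppW Hg => //; rewrite ge_min lexx orbT.
Qed.

Let supp3 f g h : is_puiseux f -> is_puiseux g -> is_puiseux h ->
  exists N m, [/\ (0 < N)%N, supp N m f, supp N m g & supp N m h].
Proof.
move=> /supp2 H /H [N [m [N0 Hf Hg]]] /puiseux_supp[M [p [M0 Hh]]].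
exists (N * M)%N, (Num.min (m * M%:Z) (p * N%:Z)); split.
- by rewrite muln_gt0 N0.
- by apply: suppW Hf => //; rewrite ge_min lexx.
- by apply: suppW Hg => //; rewrite ge_min lexx.
- by rewrite mulnC; apply: suppW Hh => //; rewrite ge_min lexx orbT.
Qed.

Let exD N m p i j : ex N (m + p) (i + j) = ex N m i + ex N p j.
Proof. by rewrite /ex -mulrDl -intrD PoszD addrACA. Qed.

Let conv_lau N m p a b : (0 < N)%N ->
  puiseux_conv (lau N m a) (lau N p b) = lau N (m + p) (ps_mul a b).
Proof.
move=> N0; apply/funext => q; rewrite /puiseux_conv.
have [[k ->]|Hq] := exP N (m + p) q; last first.
  rewrite lau_out // fsbig1 // => s _.
  have [[i ->]|Hs] := exP N m s; last by rewrite lau_out ?mul0r.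
  rewrite [X in _ * X]lau_out ?mulr0 // => j E; apply: (Hq (i + j)%N).
  by rewrite exD -E [RHS]addrC subrK.
rewrite lau_ex //.
rewrite (fsbigE [seq ex N m i | i <- iota 0 k.+1]) //; first last.
- move=> s _ Hs; have [[i si]|Hs'] := exP N m s; last by rewrite lau_out ?mul0r.
  have [ik|ki] := leqP i k.
    by case/negP: Hs; rewrite si; apply: map_f; rewrite mem_iota add0n ltnS.
  rewrite [X in _ * X]lau_out ?mulr0 // => j E.
  have {}E : ex N (m + p) k = ex N (m + p) (i + j).
    by rewrite [RHS]exD -E si [RHS]addrC subrK.
  by move/(ex_inj N0): E ki => ->; rewrite ltnNge leq_addr.
- by rewrite (map_inj_uniq (ex_inj N0)) iota_uniq.
rewrite big_map -[iota 0 k.+1]/(index_iota 0 k.+1) big_mkord.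
apply: eq_big => [i|i _]; first by rewrite in_setT.
rewrite lau_ex //; congr (_ * _).
have ik : (i <= k)%N by rewrite -ltnS.
have -> : ex N (m + p) k - ex N m i = ex N p (k - i).
  have := exD N m p i (k - i); rewrite subnKC // => ->.
  by rewrite addrAC subrr add0r.
exact: lau_ex.
Qed.

Let addl N m a b : lau N m a + lau N m b = lau N m (fun k => a k + b k).
Proof.
by apply/funext => q; rewrite /lau /GRing.add /=; case: ifP; rewrite ?addr0.
Qed.

Let oppl N m a : - lau N m a = lau N m (fun k => - a k).
Proof.
by apply/funext => q; rewrite /lau /GRing.opp /=; case: ifP; rewrite ?oppr0.
Qed.

Fact puiseux_zmod_closed : zmod_closed puiseux_pred.
Proof.
split; first by apply/asboolP; exists 1%N, 0; split=> // q; rewrite eqxx.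
move=> f g /asboolP Hf /asboolP Hg; apply/asboolP.
have [N [m [N0 {}Hf {}Hg]]] := supp2 Hf Hg.
by rewrite (lau_of N0 Hf) (lau_of N0 Hg) oppl addl; apply: lau_puiseux.
Qed.

HB.instance Definition _ :=
  GRing.isZmodClosed.Build (rat -> F) puiseux_pred puiseux_zmod_closed.

Record puiseux := Puiseux { pcoef :> rat -> F; _ : pcoef \in puiseux_pred }.

HB.instance Definition _ := [isSub for pcoef].
HB.instance Definition _ := [Choice of puiseux by <:].
HB.instance Definition _ := [SubChoice_isSubZmodule of puiseux by <:].

Lemma puiseuxP (x : puiseux) : is_puiseux x.
Proof. by case: x => f Hf; apply/asboolP. Qed.

Fact puiseux_conv_closed f g :
  f \in puiseux_pred -> g \in puiseux_pred -> puiseux_conv f g \in puiseux_pred.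
Proof.
move=> /asboolP Hf /asboolP Hg; apply/asboolP.
have [N [m [N0 {}Hf {}Hg]]] := supp2 Hf Hg.
by rewrite (lau_of N0 Hf) (lau_of N0 Hg) conv_lau //; apply: lau_puiseux.
Qed.

Let delta_lau N : (0 < N)%N -> puiseux_delta = lau N 0 (@ps_one F).
Proof.
move=> N0; apply/funext => q; have ex0 : ex N 0 0 = 0 by rewrite /ex mul0r.
have [[k ->]|H] := exP N 0 q; last first.
  by rewrite lau_out // /puiseux_delta; case: eqP => // E; case: (H 0%N); rewrite ex0.
by rewrite lau_ex // /puiseux_delta /ps_one -{1}ex0 (inj_eq (ex_inj N0)).
Qed.

Fact puiseux_delta_closed : puiseux_delta \in puiseux_pred.
Proof.
by apply/asboolP; rewrite (@delta_lau 1) //; apply: lau_puiseux.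
Qed.

Definition puiseux_one : puiseux := Puiseux puiseux_delta_closed.
Definition puiseux_mul (x y : puiseux) : puiseux :=
  Puiseux (puiseux_conv_closed (valP x) (valP y)).

Fact puiseux_mulC : commutative puiseux_mul.
Proof.
move=> x y; apply: val_inj => /=.
have [N [m [N0 Hx Hy]]] := supp2 (puiseuxP x) (puiseuxP y).
by rewrite (lau_of N0 Hx) (lau_of N0 Hy) !conv_lau // ps_mulC.
Qed.

Fact puiseux_mulA : associative puiseux_mul.
Proof.
move=> x y z; apply: val_inj => /=.
have [N [m [N0 Hx Hy Hz]]] := supp3 (puiseuxP x) (puiseuxP y) (puiseuxP z).
rewrite (lau_of N0 Hx) (lau_of N0 Hy) (lau_of N0 Hz) !conv_lau //.
by rewrite ps_mulA addrA.
Qed.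

Fact puiseux_mul1 : left_id puiseux_one puiseux_mul.
Proof.
move=> x; apply: val_inj => /=.
have [N [m [N0 Hx]]] := puiseux_supp (puiseuxP x).
by rewrite (lau_of N0 Hx) (delta_lau N0) conv_lau // ps_mul1 add0r.
Qed.

Fact puiseux_mulDl : left_distributive puiseux_mul +%R.
Proof.
move=> x y z; apply: val_inj => /=.
have [N [m [N0 Hx Hy Hz]]] := supp3 (puiseuxP x) (puiseuxP y) (puiseuxP z).
rewrite (lau_of N0 Hx) (lau_of N0 Hy) (lau_of N0 Hz) addl !conv_lau // addl.
by congr lau; apply/funext => n; rewrite ps_mulDl.
Qed.

Fact puiseux_one_neq0 : puiseux_one != 0.
Proof.
apply/eqP => /(congr1 (fun x : puiseux => x 0)) /eqP.
by rewrite /= /puiseux_delta eqxx oner_eq0.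
Qed.

HB.instance Definition _ := GRing.Zmodule_isComNzRing.Build puiseux
  puiseux_mulA puiseux_mulC puiseux_mul1 puiseux_mulDl puiseux_one_neq0.

(* Minimum exponent of a nonzero series. *)
Lemma puiseux_min (x : puiseux) : x != 0 ->
  exists2 q, x q != 0 & forall s, x s != 0 -> q <= s.
Proof.
have [N [m [N0 Hx]]] := puiseux_supp (puiseuxP x) => x0.
have [q xq] : exists q, x q != 0.
  apply: contrapT => H; case/eqP: x0; apply: val_inj; apply/funext => q.
  by apply/eqP; apply: contrapT => /negP xq; apply: H; exists q.
have [k qk] := Hx _ xq.
have Hex : exists k, x (ex N m k) != 0 by exists k; rewrite -qk.
case: (ex_minnP Hex) => k0 Hk0 kmin; exists (ex N m k0) => // s xs.
have [j sj] := Hx _ xs; rewrite sj /ex ler_pM2r ?invr_gt0 ?ltr0n //.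
by rewrite ler_int lerD2l lez_nat kmin // -sj.
Qed.

Fact puiseux_inv_ex (x : puiseux) : x != 0 -> exists y : puiseux, y * x = 1.
Proof.
move=> x0; have [q xq qmin] := puiseux_min x0.
have [N [m [N0 Hx]]] := puiseux_supp (puiseuxP x).
have [k qk] := Hx _ xq.
have Hx' : supp N (m + k%:Z) x.
  move=> s xs; have [j sj] := Hx _ xs; have := qmin _ xs.
  rewrite qk sj /ex ler_pM2r ?invr_gt0 ?ltr0n // ler_int lerD2l lez_nat => kj.
  by exists (j - k)%N; rewrite -addrA -PoszD subnKC.
set a := fun j => x (ex N (m + k%:Z) j).
have a0 : a 0 != 0 by rewrite /a /ex addr0 -/(ex N m k) -qk.
have Hy : lau N (- (m + k%:Z)) (ps_inv a) \in puiseux_pred.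
  by apply/asboolP; apply: lau_puiseux.
exists (Puiseux Hy); apply: val_inj => /=.
by rewrite (lau_of N0 Hx') conv_lau // addNr -/a ps_invP // -delta_lau.
Qed.

Definition puiseux_inv (x : puiseux) : puiseux :=
  if pselect (exists y : puiseux, y * x = 1) is left H then projT1 (cid H) else 0.

Fact puiseux_mulVf (x : puiseux) : x != 0 -> puiseux_inv x * x = 1.
Proof.
move=> /puiseux_inv_ex H; rewrite /puiseux_inv; case: pselect => // H'.
by case: (cid H').
Qed.

Fact puiseux_inv0 : puiseux_inv 0 = 0.
Proof.
rewrite /puiseux_inv; case: pselect => // H; exfalso; have [y /eqP] := H.
by rewrite mulr0 eq_sym oner_eq0.
Qed.

HB.instance Definition _ :=
  GRing.ComNzRing_isField.Build puiseux puiseux_mulVf puiseux_inv0.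

End Puiseux.

Section Lattice.
Variable R : realType.
Notation K := (puiseux R[i]).

(* Minimum exponent of x, as an extended real; equal to +oo at x = 0. *)
Definition puiseux_val (x : K) : \bar R :=
  ereal_inf [set (ratr q)%:E | q in [set q : rat | x q != 0]].

Lemma puiseux_val0 : puiseux_val 0 = +oo%E.
Proof.
rewrite /puiseux_val (_ : [set q : rat | _] = set0) ?image_set0 ?ereal_inf0 //.
by apply/seteqP; split=> // q /=; rewrite eqxx.
Qed.

Lemma puiseux_val_min (x : K) : x != 0 -> exists q : rat,
  [/\ x q != 0, forall s, x s != 0 -> q <= s & puiseux_val x = (ratr q)%:E].
Proof.
move=> /puiseux_min[q xq qmin]; exists q; split=> //.
apply/eqP; rewrite eq_le; apply/andP; split.
  by apply: ereal_inf_lbound; exists q.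
by apply: le_ereal_inf_tmp => _ [s xs <-]; rewrite lee_fin ler_rat qmin.
Qed.

Definition val_ring : set K := [set x | (0 <= puiseux_val x)%E].

Section Dimensions.
Variables r n : nat.
Implicit Types (A : 'M[K]_(r, n)) (L : set 'rV[K]_n).

Definition lattice_basis A L : Prop :=
  row_free A /\
  L = [set x | exists c : 'rV[K]_r, (forall i, val_ring (c 0 i)) /\ x = c *m A].

Definition K_span L : set 'rV[K]_n :=
  [set x | exists (m : nat) (c : 'I_m -> K) (y : 'I_m -> 'rV[K]_n),
     (forall i, L (y i)) /\ x = \sum_(i < m) c i *: y i].

Definition coord_hyperplane (j : 'I_n) : set 'rV[K]_n := [set x | x 0 j = 0].

(* The submatrix A_{I x J}, rows and columns in increasing order.  Only used
   when #|I| = #|J|, in which case conform_mx merely casts the number of rows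
   (otherwise it would return its first argument). *)
Definition minor_mx A (I : {set 'I_r}) (J : {set 'I_n}) : 'M[K]_#|J| :=
  conform_mx 0 (mxsub (fun i : 'I_#|I| => enum_val i)
                      (fun j : 'I_#|J| => enum_val j) A).

Lemma minor_mxE A (I : {set 'I_r}) (J : {set 'I_n}) (e : #|I| = #|J|) i j :
  minor_mx A I J i j = A (enum_val (cast_ord (esym e) i)) (enum_val j).
Proof.
rewrite /minor_mx /conform_mx; case: eqP => // e1; case: eqP => // e2.
by rewrite castmxE mxE (eq_irrelevance e1 e) cast_ord_id.
Qed.

Definition entropy A (J : {set 'I_n}) : \bar R :=
  \big[mine/+oo%E]_(I : {set 'I_r} | #|I| == #|J|)
    puiseux_val (\det (minor_mx A I J)).

Lemma entropy0 A : entropy A finset.set0 = 0%E.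
Proof.
rewrite /entropy (big_pred1 finset.set0) => [|I]; last by rewrite cards0 cards_eq0.
have -> : \det (minor_mx A finset.set0 finset.set0) = 1.
  move: (minor_mx _ _ _); rewrite cards0 => M; exact: det_mx00.
have [q [q1 _ ->]] := puiseux_val_min (oner_neq0 K).
move: q1; rewrite [pcoef _ _]/(puiseux_delta _ q) /puiseux_delta.
by have [->|] := eqVneq q 0; rewrite ?rmorph0 ?eqxx.
Qed.

Lemma entropy_gt A (J : {set 'I_n}) : (r < #|J|)%N -> entropy A J = +oo%E.
Proof.
move=> rJ; rewrite /entropy big_pred0 // => I; apply/negbTE; apply: contraTneq rJ.
by move=> <-; rewrite -leqNgt -[X in (_ <= X)%N]card_ord max_card.
Qed.

End Dimensions.
End Lattice.

Section EntropyComplex.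
Variables (R : realType) (n : nat).
Implicit Types (h : {set 'I_n} -> \bar R) (v : 'rV[R]_n) (P tau : set 'rV[R]_n)
  (J : {set 'I_n}).

Definition affine_piece h J v : \bar R := ((\sum_(j in J) v 0 j)%:E - h J)%E.

Definition entropy_poly h v : \bar R :=
  \big[maxe/-oo%E]_(J : {set 'I_n}) affine_piece h J v.

Definition region h J : set 'rV[R]_n :=
  [set v | entropy_poly h v = affine_piece h J v].

(* P contains n + 1 affinely independent points. *)
Definition full_dimensional P : Prop :=
  exists (x : 'rV[R]_n) (D : 'M[R]_n),
    [/\ row_free D, P x & forall i, P (x + row i D)].

Definition maximal_cell h J : Prop := full_dimensional (region h J).

(* Nonempty faces: the loci where a linear form attains its maximum over P
   (P itself for the zero form). *)
Definition face tau P : Prop :=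
  tau !=set0 /\ exists c : 'rV[R]_n, tau =
    [set x | P x /\ forall y, P y ->
       \sum_(j < n) c 0 j * y 0 j <= \sum_(j < n) c 0 j * x 0 j].

Definition entropy_complex h : set (set 'rV[R]_n) :=
  [set tau | exists J, maximal_cell h J /\ face tau (region h J)].

(* On a maximal cell region h J this union is J itself, since full-dimensional
   regions of distinct J are not contained in one another. *)
Definition cell_label h tau : {set 'I_n} :=
  (\bigcup_(J | `[< maximal_cell h J /\ (tau `<=` region h J)%classic >]) J)%SET.

Definition Sigma h : set (set 'rV[R]_n) :=
  [set tau | entropy_complex h tau /\ cell_label h tau = [set: 'I_n]%SET].

Definition Sigma_support h : set 'rV[R]_n := \bigcup_(tau in Sigma h) tau.

End EntropyComplex.

(* Tropical vectors have entries in R and +oo; the entry -oo of \bar R never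
   occurs in them. *)
Section Tropical.
Variables (R : realType) (n : nat).
Implicit Types (x y : 'rV[\bar R]_n).

Definition trop_add x y : 'rV[\bar R]_n := \row_j mine (x 0%R j) (y 0%R j).
Definition trop_scale (lam : R) x : 'rV[\bar R]_n := \row_j (lam%:E + x 0%R j)%E.
Definition trop_zero : 'rV[\bar R]_n := const_mx +oo%E.

Definition trop_embed (v : 'rV[R]_n) : 'rV[\bar R]_n := map_mx EFin v.

Definition generator (h : {set 'I_n} -> \bar R) (J : {set 'I_n}) : 'rV[\bar R]_n :=
  \row_j (if j \in J then +oo else h (j |: J)%SET - h J)%E.

Definition generator_comb (h : {set 'I_n} -> \bar R)
    (lam : {set 'I_n} -> R) : 'rV[\bar R]_n :=
  \big[trop_add/trop_zero]_(J : {set 'I_n} |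
      (J \proper [set: 'I_n]%SET) && (h J != +oo%E))
    trop_scale (lam J) (generator h J).

End Tropical.

(* Main.v *)
(* Write [v_J - h J] for the weight of [J] at [v].  Every subset is a vertex of
   the unit cube, so every [J] with [h J] finite labels a maximal cell, and [v]
   lies in the support of Sigma iff every [j] belongs to some maximizer of the
   weight at [v].

   The entropy vector has the exchange property of a valuated generalized
   matroid: up to sign, the minors of [A] of all sizes are the maximal minors of
   [(1 | A)], and taking valuations in the Grassmann-Plücker relation for two
   optimal minors exhibits an exchange that does not increase the sum.

   If [v] is in the support, let [lam J] be the least nonnegative scalar for
   which [lam J + u_J >= v]; for a maximizer [M] containing [j], equality at [j]
   holds for [J = M \ j].  Conversely, if [v] is the combination with
   coefficients [lam] and the minimum defining [v_j] is attained at [J], then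
   [j |: J] has at least the weight of [J] and of all [k |: J]; exchanging [j]
   between [j |: J] and any maximizer then produces a maximizer containing [j].
   The semimodule property is immediate for combinations of generators. *)

Require Import Defs.
From HB Require Import structures.
From mathcomp Require Import all_boot all_order all_algebra.
From mathcomp Require Import all_classical all_reals ereal.
From mathcomp Require Import complex.
From mathcomp Require Import lra.
Set Implicit Arguments.
Unset Strict Implicit.
Unset Printing Implicit Defensive.
Import Order.TTheory GRing.Theory Num.Theory.
Local Open Scope classical_set_scope.
Local Open Scope ring_scope.

(** * Valuation of Puiseux series *)

Section Valuation.
Variable R : realType.
Notation K := (puiseux R[i]).
Implicit Types x y : K.
Local Open Scope ereal_scope.

Lemma puiseux_mul_coef x y q :
  (x * y)%R q = (\sum_(s \in [set: rat]) x s * y (q - s))%R.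
Proof. by []. Qed.

Lemma puiseux_add_coef x y q : (x + y)%R q = (x q + y q)%R.
Proof. by []. Qed.

Lemma puiseux_val_le x q : x q != 0%R -> puiseux_val x <= (ratr q)%:E.
Proof. by move=> xq; apply: ereal_inf_lbound; exists q. Qed.

Lemma puiseux_val_eqy x : (puiseux_val x == +oo) = (x == 0%R).
Proof.
have [->|/puiseux_val_min[q [_ _ ->]]] := eqVneq x 0%R; last by [].
by rewrite puiseux_val0.
Qed.

Lemma puiseux_val_neqNy x : puiseux_val x != -oo.
Proof.
have [->|/puiseux_val_min[q [_ _ ->]]] := eqVneq x 0%R; last by [].
by rewrite puiseux_val0.
Qed.

(** At exponent [p + q] only the product of the two leading coefficients survives, and every
    exponent of [x * y] is a sum of an exponent of [x] and one of [y]. *)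
Lemma puiseux_valM x y : puiseux_val (x * y)%R = puiseux_val x + puiseux_val y.
Proof.
have [->|x0] := eqVneq x 0%R.
  by rewrite mul0r puiseux_val0 addye // puiseux_val_neqNy.
have [->|y0] := eqVneq y 0%R.
  by rewrite mulr0 puiseux_val0 addey // puiseux_val_neqNy.
have [p [xp pmin ->]] := puiseux_val_min x0.
have [q [yq qmin ->]] := puiseux_val_min y0.
rewrite -EFinD -rmorphD; apply/eqP; rewrite eq_le; apply/andP; split.
  apply: puiseux_val_le; rewrite puiseux_mul_coef.
  rewrite -(fsbig_widen [set p]) // => [|s [_ /= sp]].
    by rewrite fsbig_set1 addrAC subrr add0r mulf_neq0.
  apply/eqP; rewrite mulf_eq0 -[_ || _]negbK negb_or.
  apply/andP => -[/pmin ps /qmin]; rewrite lerBrDl lerD2r => sp'.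
  by apply: sp; apply/eqP; rewrite eq_le sp' ps.
apply: le_ereal_inf_tmp => _ [s /= xys <-]; rewrite lee_fin ler_rat.
have [u _] := fsbigN1 (xys : \big[+%R/0%R]_(y0 \in _) (fun s u => x u * y (s - u)) s y0 != 0)%R.
rewrite mulf_eq0 negb_or => /andP[/pmin pu /qmin qsu].
by rewrite -(subrK u s) addrC lerD.
Qed.

Lemma puiseux_valD x y (m : \bar R) :
  m <= puiseux_val x -> m <= puiseux_val y -> m <= puiseux_val (x + y)%R.
Proof.
move=> mx my; apply: le_ereal_inf_tmp => _ [q xyq <-].
have [xq0|/puiseux_val_le] := eqVneq (x q) 0%R; last exact: le_trans.
apply: le_trans my _; apply: puiseux_val_le; move: (xyq : (x + y)%R q != 0%R).
by rewrite puiseux_add_coef xq0 add0r.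
Qed.

(** By the ultrametric inequality; the hypothesis rules out the default [+oo] of the minimum. Its
    use is to single out one term of a Plücker relation. *)
Lemma puiseux_val_sum (I : finType) (f : I -> K) :
  puiseux_val (\sum_i f i)%R != +oo ->
  exists i, puiseux_val (f i) <= puiseux_val (\sum_i f i)%R.
Proof.
move=> f0; pose m := \big[mine/+oo]_i puiseux_val (f i).
have : m <= puiseux_val (\sum_i f i)%R.
  apply: (big_ind (fun z => m <= puiseux_val z)) => [|x y|i _].
  - by rewrite puiseux_val0 leey.
  - exact: puiseux_valD.
  - exact: bigmin_le.
case/bigmin_leP => [|[i _ mi]]; last by exists i.
by rewrite leye_eq (negPf f0).
Qed.

Lemma puiseux_val_sign (b : bool) x : puiseux_val ((-1) ^+ b * x)%R = puiseux_val x.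
Proof.
case: b; rewrite (expr0, expr1) ?mul1r // mulN1r; congr (ereal_inf (_ @` _)).
by apply/seteqP; split=> q /=; rewrite oppr_eq0.
Qed.

End Valuation.

(** * Plücker relations *)

Section Plucker.
Variables (K : comNzRingType) (T : Type) (r : nat) (C : T -> 'rV[K]_r).
Implicit Types s t : 'I_r -> T.

Definition row_det s : K := \det (\matrix_p C (s p)).

Lemma row_det_replace s p x :
  row_det [eta s with p |-> x] = (C x *m \adj (\matrix_i C (s i))) 0 p.
Proof.
rewrite /row_det (expand_det_row _ p) mxE; apply: eq_bigr => j _.
rewrite !mxE /= eqxx; congr (_ * (_ * \det _)).
by apply/matrixP=> a b; rewrite !mxE /= eq_sym (negPf (neq_lift _ _)).
Qed.

(** Both sides evaluate entry [p] of [row p M *m \adj N *m N *m \adj M]: contracting [\adj N *m N]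
    to [\det N] gives the product, splitting between these two factors gives the sum by Cramer's
    rule. *)
Lemma row_det_plucker s t p :
  row_det s * row_det t =
  \sum_q row_det [eta s with p |-> t q] * row_det [eta t with q |-> s p].
Proof.
set M := \matrix_i C (s i); set N := \matrix_i C (t i).
transitivity ((row p M *m \adj N *m N *m \adj M) 0 p).
  rewrite -(mulmxA (row p M)) mul_adj_mx mul_mx_scalar -scalemxAl mxE mulrC.
  congr (_ * _); rewrite -row_mul mul_mx_adj.
  by rewrite !mxE eqxx.
rewrite -mulmxA mxE; apply: eq_bigr => q _; rewrite mulrC; congr (_ * _).
  by rewrite row_det_replace -/M -(rowK (fun i => C (t i)) q) -row_mul [RHS]mxE.
by rewrite row_det_replace -/N rowK.
Qed.

End Plucker.

Lemma card_pred_sum (I J : finType) (P : pred (I + J)) :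
  #|P| = (#|[pred a | P (inl a)]| + #|[pred b | P (inr b)]|)%N.
Proof. by rewrite -!sum1_card big_sumType. Qed.

(** * Determinants of reindexed row selections *)

Section RowSelections.
Variables (K : comNzRingType) (r : nat).

(** Rows and columns undergo the same permutation, so the signs cancel. The equality [k = r] is
    propositional to allow sizes such as [#|I| + #|~: I|]. *)
Lemma det_mxsub_inj k (f : 'I_k -> 'I_r) (M : 'M[K]_r) :
  k = r -> injective f -> \det (mxsub f f M) = \det M.
Proof.
move=> kr; move: kr f => -> f f_inj; pose s := perm.perm f_inj.
have -> : mxsub f f M = row_perm s (col_perm s M).
  by apply/matrixP => i j; rewrite !mxE !perm.permE.
rewrite row_permE col_permE !det_mulmx !det_perm perm.odd_permV.
by rewrite mulrC -mulrA -signr_addb addbb mulr1.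
Qed.

(** Preimages under [t] define an injective self-map of ['I_r], hence a permutation, whose sign is
    the factor. *)
Lemma row_det_reindex (T : Type) (C : T -> 'rV[K]_r) (s t : 'I_r -> T) :
  injective s -> (forall p, exists q, t q = s p) ->
  exists b : bool, row_det C s = (-1) ^+ b * row_det C t.
Proof.
move=> s_inj /choice[g tg].
have g_inj : injective g by move=> p q gpq; apply: s_inj; rewrite -!tg gpq.
exists (perm.odd_perm (perm.perm g_inj)).
rewrite -det_perm -det_mulmx -row_permE; congr (\det _).
by apply/matrixP => i j; rewrite !mxE perm.permE tg.
Qed.

Lemma row_det_inj (T : Type) (C : T -> 'rV[K]_r) (s : 'I_r -> T) :
  row_det C s != 0 -> injective s.
Proof.
move=> s0 p q spq; apply/eqP; apply: contraNT s0 => pq.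
by apply/eqP; apply: (determinant_alternate pq) => j; rewrite !mxE spq.
Qed.

Lemma codom_update (I : finType) (T : eqType) (s : I -> T) p x y : injective s ->
  (y \in codom [eta s with p |-> x]) = (y == x) || (y != s p) && (y \in codom s).
Proof.
move=> s_inj; apply/codomP/idP => [[q] /=|/orP[/eqP ->|/andP[ysp /codomP[q yq]]]].
- case: (eqVneq q p) => [_ ->|qp ->]; first by rewrite eqxx.
  by rewrite codom_f (inj_eq s_inj) qp orbT.
- by exists p; rewrite /= eqxx.
- exists q; rewrite /=; case: eqVneq => // qp.
  by rewrite yq qp eqxx in ysp.
Qed.

End RowSelections.

(** * Exchange property of the entropy vector *)

Section EntropyExchange.
Variables (R : realType) (r n : nat) (A : 'M[puiseux R[i]]_(r, n)).
Notation K := (puiseux R[i]).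
Local Notation T := ('I_r + 'I_n)%type.
Implicit Types (I : {set 'I_r}) (J X Y : {set 'I_n}) (s t : 'I_r -> T).

(* The columns of the block matrix (1 | A), whose maximal minors are, up to
   sign, the minors of A of all sizes. *)
Definition augmented_col (x : T) : 'rV[K]_r :=
  match x with inl a => delta_mx 0 a | inr j => (col j A)^T end.

Local Notation D := (row_det augmented_col).

Definition selected_cols s : {set 'I_n} := [set j | inr j \in codom s]%SET.

Definition minor_selection I J (e : #|I| = #|J|) (a : 'I_r) : T :=
  if [pick k : 'I_#|I| | enum_val k == a] is Some k
  then inr (enum_val (cast_ord e k)) else inl a.

Lemma minor_selection_in I J (e : #|I| = #|J|) k :
  minor_selection e (enum_val k) = inr (enum_val (cast_ord e k)).
Proof.
rewrite /minor_selection; case: pickP => [l /eqP/enum_val_inj -> //|/(_ k)].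
by rewrite eqxx.
Qed.

Lemma minor_selection_out I J (e : #|I| = #|J|) a :
  a \notin I -> minor_selection e a = inl a.
Proof.
move=> aI; rewrite /minor_selection; case: pickP => // k /eqP ka.
by rewrite -ka enum_valP in aI.
Qed.

Lemma minor_selection_col I J (e : #|I| = #|J|) j :
  j \in J -> exists a, minor_selection e a = inr j.
Proof.
move=> jJ; exists (enum_val (cast_ord (esym e) (enum_rank_in jJ j))).
by rewrite minor_selection_in cast_ordKV enum_rankK_in.
Qed.

Lemma minor_selection_cols I J (e : #|I| = #|J|) :
  selected_cols (minor_selection e) = J.
Proof.
apply/setP => j; rewrite inE; apply/codomP/idP => [[a]|/(minor_selection_col e)[a]].
  rewrite /minor_selection; case: pickP => // k _ [->]; exact: enum_valP.
by move=> <-; exists a.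
Qed.

(** With [I] listed first, the rows outside [I] are unit vectors, so the matrix is block upper
    triangular with an identity block; the other diagonal block is the transposed minor. *)
Lemma row_det_minor I J (e : #|I| = #|J|) :
  D (minor_selection e) = \det (minor_mx A I J).
Proof.
pose f (x : 'I_(#|I| + #|~: I|)) : 'I_r :=
  match fintype.split x with inl k => enum_val k | inr k => enum_val k end.
have f_inj : injective f.
  have H (k : 'I_#|I|) (l : 'I_#|~: I|) : enum_val k <> enum_val l.
    by move=> kl; have := enum_valP l; rewrite inE -kl enum_valP.
  move=> x y; rewrite /f -(fintype.splitK x) -(fintype.splitK y) !unsplitK.
  case: (fintype.split x) (fintype.split y) => k [] l; first by move/enum_val_inj ->.
  - by move/H.
  - by move/esym/H.
  - by move/enum_val_inj ->.
have cardI : (#|I| + #|~: I|)%N = r by rewrite cardsC card_ord.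
rewrite /row_det -(det_mxsub_inj _ cardI f_inj) -[RHS]det_tr.
rewrite -(@det_mxsub_inj _ _ _ (cast_ord e) _ e) => [|]; last exact: cast_ord_inj.
set M := mxsub f f _.
have fl k : f (lshift _ k) = enum_val k by rewrite /f (unsplitK (inl k)).
have fr k : f (rshift _ k) = enum_val k by rewrite /f (unsplitK (inr k)).
have outI (k : 'I_#|~: I|) : enum_val k \notin I.
  by have := enum_valP k; rewrite inE.
have M_dl : dlsubmx M = 0.
  apply/matrixP => k l; rewrite !mxE fl fr minor_selection_out //= mxE eqxx /=.
  by case: eqP => // lk; case/negP: (outI k); rewrite -lk enum_valP.
have M_dr : drsubmx M = 1%:M.
  apply/matrixP => k l; rewrite !mxE !fr minor_selection_out //= mxE eqxx /=.
  by rewrite (inj_eq enum_val_inj) eq_sym.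
rewrite -[M]submxK M_dl M_dr det_ublock det1 mulr1; congr (\det _).
apply/matrixP => k l; rewrite !mxE !fl minor_selection_in /= !mxE.
by rewrite (minor_mxE _ e) cast_ordK.
Qed.

Lemma entropy_le_row_det s : (entropy A (selected_cols s) <= puiseux_val (D s))%E.
Proof.
have [->|Ds] := eqVneq (D s) 0; first by rewrite puiseux_val0 leey.
have s_inj := row_det_inj Ds.
pose I := [set a : 'I_r | inl a \notin codom s]%SET.
(* The [r] values of [s] are distinct, so it uses as many columns of [A] as it omits unit
   vectors. *)
have e : #|I| = #|selected_cols s|.
  pose P x := x \in codom s.
  have rE : (#|[pred a | P (inl a)]| + #|[pred j | P (inr j)]|)%N = r.
    by rewrite -card_pred_sum (card_codom s_inj) card_ord.
  rewrite (_ : #|I| = #|[predC [pred a | P (inl a)]]|); last first.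
    by apply: eq_card => a; rewrite !inE.
  rewrite (_ : #|selected_cols s| = #|[pred j | P (inr j)]|); last first.
    by apply: eq_card => j; rewrite !inE.
  apply/eqP; rewrite -(eqn_add2l #|[pred a | P (inl a)]|) rE.
  by apply/eqP; rewrite [LHS]cardC card_ord.
have [p|b ->] := row_det_reindex augmented_col (t := minor_selection e) s_inj.
  case sp : (s p) => [a|j].
    by exists a; rewrite minor_selection_out // inE negbK -sp codom_f.
  by apply: minor_selection_col; rewrite inE -sp codom_f.
rewrite puiseux_val_sign row_det_minor.
by apply: bigmin_le_cond; rewrite e.
Qed.

Lemma entropy_row_det J : entropy A J != +oo%E ->
  exists s, selected_cols s = J /\ puiseux_val (D s) = entropy A J.
Proof.
move=> hJ; have := lexx (entropy A J); rewrite {1}/entropy.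
case/bigmin_leP => [|[I /eqP e le_h]]; first by rewrite leye_eq (negPf hJ).
exists (minor_selection e); rewrite minor_selection_cols row_det_minor; split=> //.
apply/eqP; rewrite eq_le le_h; apply: bigmin_le_cond; exact/eqP.
Qed.

Lemma entropy_neqNy J : entropy A J != -oo%E.
Proof.
have [->//|/entropy_row_det[s [_ <-]]] := eqVneq (entropy A J) +oo%E.
exact: puiseux_val_neqNy.
Qed.

Lemma entropy_exchange X Y i : i \in X -> i \notin Y ->
  entropy A X != +oo%E -> entropy A Y != +oo%E ->
  (entropy A (X :\ i) + entropy A (i |: Y) <= entropy A X + entropy A Y)%E \/
  exists2 k, k \in Y :\: X &
    (entropy A (k |: X :\ i) + entropy A (i |: Y :\ k)
       <= entropy A X + entropy A Y)%E.
Proof.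
move=> iX iY hX hY.
have [s [sX vs]] := entropy_row_det hX; have [t [tY vt]] := entropy_row_det hY.
have Ds : D s != 0 by rewrite -puiseux_val_eqy vs.
have Dt : D t != 0 by rewrite -puiseux_val_eqy vt.
have hXY : (entropy A X + entropy A Y)%E != +oo%E.
  move: hX hY (entropy_neqNy X) (entropy_neqNy Y).
  by case: (entropy A X) (entropy A Y) => [x||] [y||].
have /codomP[p sp] : inr i \in codom s by move: iX; rewrite -sX inE.
have := puiseux_valM (D s) (D t).
rewrite (row_det_plucker _ s t p) vs vt => vst.
have [|q] := puiseux_val_sum (f := fun q =>
  D [eta s with p |-> t q] * D [eta t with q |-> s p]); first by rewrite vst.
rewrite {}vst puiseux_valM.
set s' := [eta s with p |-> t q]; set t' := [eta t with q |-> s p] => le_st.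
(* A repeated row would give the chosen term valuation [+oo], above the finite bound. *)
have s'_inj : injective s'.
  apply: (@row_det_inj _ _ _ augmented_col); apply: contraTneq le_st => ->.
  by rewrite puiseux_val0 addye ?puiseux_val_neqNy // leye_eq.
have {le_st} le_h : (entropy A (selected_cols s') + entropy A (selected_cols t')
    <= entropy A X + entropy A Y)%E.
  by apply: le_trans le_st; rewrite leeD // entropy_le_row_det.
have s'E j : (j \in selected_cols s') = (inr j == t q) || (j != i) && (j \in X).
  by rewrite -sX !inE codom_update -?sp //; apply: row_det_inj Ds.
have t'E j : (j \in selected_cols t') = (j == i) || (inr j != t q) && (j \in Y).
  by rewrite -tY !inE codom_update -?sp //; apply: row_det_inj Dt.
(* A unit vector [t q] means that [i] moves from [X] to [Y] with nothing in return; a column [k]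
   means that [i] and [k] trade places. *)
case tq: (t q) => [a|k].
  left; rewrite (_ : X :\ i = selected_cols s'); last first.
    by apply/setP => j; rewrite s'E tq !inE.
  rewrite (_ : i |: Y = selected_cols t') //.
  by apply/setP => j; rewrite t'E tq !inE.
have kY : k \in Y by rewrite -tY inE -tq codom_f.
right; exists k.
  (* If [k] were in [X], then [s'] would take the value [inr k] twice. *)
  rewrite inE kY andbT -sX inE; apply/codomP => -[p' sp'].
  have p'p : p' != p.
    by apply: contraNneq iY => p'p; move: sp'; rewrite p'p -sp => -[<-].
  have : s' p' = s' p by rewrite /s' /= eqxx (negPf p'p) -sp' tq.
  by move/s'_inj/eqP; rewrite (negPf p'p).
rewrite (_ : k |: X :\ i = selected_cols s'); last first.
  by apply/setP => j; rewrite s'E tq !inE.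
rewrite (_ : i |: Y :\ k = selected_cols t') //.
by apply/setP => j; rewrite t'E tq !inE.
Qed.

End EntropyExchange.

(** * The support of Sigma *)

Section Exchange.
Variables (R : realType) (n : nat) (h : {set 'I_n} -> \bar R).
Implicit Types (J M X Y : {set 'I_n}) (v : 'rV[R]_n).

Definition finite_at J := h J != +oo%E.

(* The exchange property of valuated generalized matroids. *)
Definition exchange_property := forall X Y i, i \in X -> i \notin Y ->
  finite_at X -> finite_at Y ->
  (h (X :\ i) + h (i |: Y) <= h X + h Y)%E \/
  exists2 k, k \in Y :\: X &
    (h (k |: X :\ i) + h (i |: Y :\ k) <= h X + h Y)%E.

(** Since [fine] sends [+oo] to 0, this is meaningful only under [finite_at J]. *)
Definition weight v J : R := \sum_(j in J) v 0 j - fine (h J).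

Lemma weightU1 v J j : j \notin J ->
  weight v (j |: J) - weight v J = v 0 j - fine (h (j |: J)) + fine (h J).
Proof. by move=> jJ; rewrite /weight big_setU1 //=; lra. Qed.

Hypothesis h_set0 : h finset.set0 = 0%E.
Hypothesis h_neqNy : forall J, h J != -oo%E.
Hypothesis h_exchange : exchange_property.

Lemma finite_set0 : finite_at finset.set0.
Proof. by rewrite /finite_at h_set0. Qed.

Lemma fine_finite_at J : finite_at J -> (fine (h J))%:E = h J.
Proof. by rewrite /finite_at; move: (h_neqNy J); case: (h J). Qed.

Lemma affine_pieceE v J : finite_at J -> affine_piece h J v = (weight v J)%:E.
Proof. by move=> hJ; rewrite /affine_piece -fine_finite_at. Qed.

Lemma affine_pieceNy v J : ~~ finite_at J -> affine_piece h J v = -oo%E.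
Proof. by rewrite negbK /affine_piece => /eqP ->. Qed.

Lemma regionP v J : region h J v <->
  finite_at J /\ forall J', finite_at J' -> weight v J' <= weight v J.
Proof.
split=> [Jv|[hJ Jmax]].
  have le_J J' : (affine_piece h J' v <= affine_piece h J v)%E.
    by rewrite -[leRHS]Jv; apply: le_bigmax.
  have hJ : finite_at J.
    (* The piece of the empty set is finite, so the maximum is not [-oo]. *)
    apply: contraT => /(affine_pieceNy v) vJ; have := le_J finset.set0.
    by rewrite vJ affine_pieceE ?finite_set0.
  by split=> // J' hJ'; rewrite -lee_fin -!affine_pieceE.
apply/eqP; rewrite eq_le; apply/andP; split; last exact: le_bigmax.
apply/bigmax_leP; split=> [|J' _]; first exact: leNye.
have [hJ'|/(affine_pieceNy v) ->] := boolP (finite_at J'); last exact: leNye.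
by rewrite !affine_pieceE // lee_fin Jmax.
Qed.

Lemma region_exists v : exists J, region h J v.
Proof.
have [J _ vJ] := @eq_bigmax _ _ _ -oo%E finset.set0 predT
  (fun J => affine_piece h J v) isT (fun J _ => leNye _).
by exists J.
Qed.

Lemma region_le v J M :
  region h M v -> finite_at J -> weight v M <= weight v J -> region h J v.
Proof.
move=> /regionP[_ Mmax] hJ MJ; apply/regionP; split=> // J' /Mmax J'M.
exact: le_trans MJ.
Qed.

(** Any [J'] other than [J] differs from it in some coordinate, which costs at least [c] in the
    linear part; this outweighs the possible gain in entropy. *)
Lemma region_orthant v J (c : R) : finite_at J -> 0 <= c ->
  (forall J', finite_at J' -> fine (h J) - fine (h J') <= c) ->
  (forall j, if j \in J then c <= v 0 j else v 0 j <= - c) -> region h J v.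
Proof.
move=> hJ c0 c_max vc; apply/regionP; split=> // J' hJ'.
have [->//|JJ'] := eqVneq J' J.
suff : \sum_(j in J') v 0 j + c <= \sum_(j in J) v 0 j.
  by have := c_max _ hJ'; rewrite /weight; lra.
rewrite addrC -lerBrDr !(big_mkcond (fun j => j \in _)) /= -sumrB.
have [j jJJ'] : exists j, (j \in J) != (j \in J').
  by apply/existsP; apply: contraNT JJ' => /existsPn E; apply/eqP/setP => j;
     have /negPn/eqP := E j.
rewrite (bigD1 j) //= -[leLHS]addr0 lerD ?sumr_ge0 // => [|k _].
- by have := vc j; move: jJJ'; case: (j \in J) (j \in J') => [] [] //= _; lra.
- by have := vc k; case: (k \in J) (k \in J') => [] [] //=; lra.
Qed.

Lemma finite_maximal_cell J : finite_at J -> maximal_cell h J.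
Proof.
move=> hJ; pose c := \big[Num.max/0]_(J' : {set 'I_n}) (fine (h J) - fine (h J')).
have c0 : 0 <= c by apply/bigmax_geP; left.
have c_max J' : finite_at J' -> fine (h J) - fine (h J') <= c.
  by move=> _; apply: (le_bigmax _ (fun J' => fine (h J) - fine (h J'))).
(* The margin 1 leaves room for a unit step along each axis inside the orthant. *)
clearbody c; exists (\row_j (if j \in J then c + 1 else - (c + 1))), 1%:M; split.
- by rewrite row_free_unit unitmx1.
- by apply: (region_orthant hJ c0 c_max) => j; rewrite mxE; case: (j \in J); lra.
- move=> i; apply: (region_orthant hJ c0 c_max) => j; rewrite !mxE.
  by case: (j \in J); case: eqP => _ /=; rewrite ?mulr1n ?mulr0n; lra.
Qed.

(** The linear form sums the differences of the indicators of [J] and [J0] over all maximizers [J]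
    at [v]. On [region h J0] it is a constant minus nonnegative weight gaps, which all vanish at
    [v]; so it is maximal exactly where they all vanish. *)
Lemma argmax_face v J0 : region h J0 v ->
  face [set x | forall J, region h J v -> region h J x] (region h J0).
Proof.
move=> J0v; split; first by exists v.
have [hJ0 _] := (regionP v J0).1 J0v.
pose Q J := `[< region h J v >].
exists (\row_j \sum_(J | Q J) ((j \in J)%:R - (j \in J0)%:R)).
set c := \row_j _.
pose kappa := \sum_(J | Q J) (fine (h J) - fine (h J0)).
have cE (y : 'rV[R]_n) : \sum_j c 0 j * y 0 j = kappa - \sum_(J | Q J) (weight y J0 - weight y J).
  under eq_bigr => j _ do rewrite mxE mulr_suml.
  rewrite exchange_big -sumrB; apply: eq_bigr => J _ /=.
  under eq_bigr => j _ do rewrite mulrBl !mulr_natl !mulrb.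
  by rewrite sumrB -!big_mkcond /weight; lra.
have gap0 y J : region h J0 y -> Q J -> 0 <= weight y J0 - weight y J.
  by move=> /regionP[_ y_max] /asboolP/regionP[hJ _]; rewrite subr_ge0 y_max.
apply/seteqP; split=> x /=.
  move=> xall; split=> [|y J0y]; first exact: xall.
  rewrite !cE lerD2l lerN2 [leLHS]big1 => [|J /asboolP Jv].
    by apply: sumr_ge0 => J; apply: gap0.
  apply/eqP; rewrite subr_eq0 eq_le.
  have /regionP[hJ J_max] := xall _ Jv; have /regionP[_ J0_max] := xall _ J0v.
  by rewrite J_max // J0_max.
move=> [J0x x_max] J Jv; have := x_max _ J0v.
rewrite !cE lerD2l lerN2 [leRHS]big1 => [gap_le|J' /asboolP J'v]; last first.
  apply/eqP; rewrite subr_eq0 eq_le.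
  have /regionP[hJ' J'_max] := J'v; have /regionP[_ J0_max] := J0v.
  by rewrite J'_max // J0_max.
have gap_eq0 : \sum_(J | Q J) (weight x J0 - weight x J) = 0.
  by apply/eqP; rewrite eq_le gap_le sumr_ge0 // => J'; apply: gap0.
have QJ : Q J by apply/asboolP.
have /subr0_eq xJ := psumr_eq0P (fun J' => gap0 x J' J0x) gap_eq0 QJ.
have /regionP[hJ _] := Jv.
by apply: (region_le J0x hJ); rewrite xJ.
Qed.

(** For the converse, the cell is the intersection of all regions through [v], so its label contains
    every maximizer at [v]. *)
Lemma Sigma_supportP v :
  Sigma_support h v <-> forall j, exists2 M : {set 'I_n}, j \in M & region h M v.
Proof.
split=> [[tau [_ tauT] tauv] j|Hv].
  have : j \in cell_label h tau by rewrite tauT finset.in_setT.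
  by case/bigcupP => M /asboolP[_ tauM] jM; exists M => //; apply: tauM.
have [J0 J0v] := region_exists v; have [hJ0 _] := (regionP v J0).1 J0v.
exists [set x | forall J, region h J v -> region h J x] => //; split.
  by exists J0; split; [exact: finite_maximal_cell|exact: argmax_face].
apply/setP => j; rewrite finset.in_setT; apply/bigcupP.
have [M jM Mv] := Hv j; exists M => //; apply/asboolP; split; last by move=> x; apply.
by apply: finite_maximal_cell; have [] := (regionP v M).1 Mv.
Qed.

(** Turns an exchange inequality in [\bar R] into a real one and records that the exchanged sets
    stay finite. *)
Lemma finite_at_add_le (X Y X' Y' : {set 'I_n}) :
  finite_at X -> finite_at Y -> (h X' + h Y' <= h X + h Y)%E ->
  [/\ finite_at X', finite_at Y' &
      fine (h X') + fine (h Y') <= fine (h X) + fine (h Y)].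
Proof.
rewrite /finite_at; move: (h_neqNy X) (h_neqNy Y) (h_neqNy X') (h_neqNy Y').
by case: (h X) (h Y) (h X') (h Y') => [x||] [y||] [x'||] [y'||].
Qed.

(** Exchange with the empty set, which has no [k] to give back. *)
Lemma finite_setD1 M j : finite_at M -> j \in M -> finite_at (M :\ j).
Proof.
move=> hM jM; have jN0 : j \notin finset.set0 by rewrite finset.in_set0.
have [|[k]] := h_exchange jM jN0 hM finite_set0; last first.
  by rewrite finset.in_setD finset.in_set0 andbF.
by case/finite_at_add_le => //; apply: finite_set0.
Qed.

Lemma maximizer_containing v J j : j \notin J ->
  finite_at J -> finite_at (j |: J) -> weight v J <= weight v (j |: J) ->
  (forall k, k \notin J -> finite_at (k |: J) ->
     weight v (k |: J) <= weight v (j |: J)) ->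
  exists2 M : {set 'I_n}, j \in M & region h M v.
Proof.
move=> jJ hJ hjJ J_le k_le; have [M Mv] := region_exists v.
have [hM M_max] := (regionP v M).1 Mv.
have [jM|jM] := boolP (j \in M); first by exists M.
(* The exchange turns [j |: J] into [J] or [k |: J], neither heavier by hypothesis, so the set
   obtained from [M] is at least as heavy as [M]. *)
have := h_exchange (setU11 j J) jM hjJ hM; rewrite setU1K //.
case=> [/finite_at_add_le[]//|[k kMJ /finite_at_add_le[]//]] hX hY le_h.
  exists (j |: M); rewrite ?setU11 //; apply: (region_le Mv) => //.
  by move: J_le le_h; rewrite /weight !big_setU1 //=; lra.
move: kMJ; rewrite !inE negb_or => /andP[/andP[kj kJ] kM].
exists (j |: M :\ k); rewrite ?setU11 //; apply: (region_le Mv) => //.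
have jMk : j \notin M :\ k by rewrite !inE (negPf jM) andbF.
move: (k_le _ kJ hX) le_h.
by rewrite /weight !big_setU1 //= (big_setD1 k kM) /=; lra.
Qed.

(** * Tropical combinations of the generators *)

Lemma generator_combE lam j : generator_comb h lam 0 j =
  \big[mine/+oo%E]_(J : {set 'I_n} | (J \proper [set: 'I_n]%SET) && finite_at J)
    ((lam J)%:E + generator h J 0%R j)%E.
Proof.
rewrite /generator_comb (big_morph (fun x : 'rV_n => x 0 j)
  (id1 := +oo%E) (op1 := fun a b => mine a b)).
- by apply: eq_bigr => J _; rewrite mxE.
- by move=> x y; rewrite mxE.
- by rewrite mxE.
Qed.

Lemma trop_scale_comb c lam :
  trop_scale c (generator_comb h lam) = generator_comb h (fun J => c + lam J).
Proof.
apply/rowP => j; rewrite mxE !generator_combE.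
rewrite (big_morph (fun x => c%:E + x)%E (id1 := +oo%E) (op1 := fun a b => mine a b)).
- by apply: eq_bigr => J _; rewrite EFinD addeA.
- by move=> x y; rewrite !minEle leeD2lE //; case: ifP.
- by [].
Qed.

Lemma trop_add_comb lam mu :
  trop_add (generator_comb h lam) (generator_comb h mu) =
  generator_comb h (fun J => Num.min (lam J) (mu J)).
Proof.
apply/rowP => j; rewrite mxE !generator_combE -bigmin_split.
apply: eq_bigr => J _; have [lam_le|/ltW mu_le] := leP (lam J) (mu J).
  by rewrite min_l // leeD2r // lee_fin.
by rewrite min_r // leeD2r // lee_fin.
Qed.

Lemma generator_in lam J j : j \in J -> ((lam J)%:E + generator h J 0%R j)%E = +oo%E.
Proof. by move=> jJ; rewrite mxE jJ. Qed.

Lemma generator_out (c : R) J j : finite_at J -> j \notin J ->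
  (c%:E + generator h J 0%R j)%E =
  if finite_at (j |: J) then (c + (fine (h (j |: J)) - fine (h J)))%:E else +oo%E.
Proof.
move=> hJ jJ; rewrite mxE (negPf jJ) -(fine_finite_at hJ) /=.
by case: ifPn => [/fine_finite_at <-|/negPn/eqP ->].
Qed.

Lemma Sigma_support_comb v : Sigma_support h v ->
  exists lam, (forall J, 0 <= lam J) /\ trop_embed v = generator_comb h lam.
Proof.
move=> /Sigma_supportP Hv.
(* Each term is the weight gained at [v] by adding [k] to [J]. *)
pose lam J := \big[Num.max/0]_(k | (k \notin J) && finite_at (k |: J))
  (v 0 k - fine (h (k |: J)) + fine (h J)).
have lam0 J : 0 <= lam J by apply/bigmax_geP; left.
exists lam; split=> //; apply/rowP => j; rewrite mxE generator_combE.
apply/eqP; rewrite eq_le; apply/andP; split.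
  apply/bigmin_geP; split=> [|J /andP[_ hJ]]; first exact: leey.
  have [jJ|jJ] := boolP (j \in J); first by rewrite generator_in ?leey.
  rewrite generator_out //; case: ifPn => hjJ; last exact: leey.
  have := @le_bigmax_cond _ _ _ 0 j (fun k => (k \notin J) && finite_at (k |: J))
    (fun k => v 0 k - fine (h (k |: J)) + fine (h J)).
  by rewrite jJ hjJ -/(lam J) lee_fin => /(_ isT); lra.
have [M jM /regionP[hM M_max]] := Hv j.
have hJ := finite_setD1 hM jM; have jJ : j \notin M :\ j by rewrite !inE eqxx.
apply: (bigmin_inf (M :\ j)).
  rewrite hJ andbT; apply/properP; split; first exact/finset.subsetT.
  by exists j; rewrite ?finset.in_setT.
rewrite generator_out // finset.setD1K // hM lee_fin.
(* As [M] is a maximizer, no addition to [M :\ j] gains more than [j] does, and the gain of [j] is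
   nonnegative. *)
suff : lam (M :\ j) <= weight v M - weight v (M :\ j).
  by have := weightU1 v jJ; rewrite finset.setD1K // => ->; lra.
apply/bigmax_leP; split=> [|k /andP[kJ hkJ]]; first by rewrite subr_ge0 M_max.
by rewrite -weightU1 // lerB // M_max.
Qed.

Lemma comb_Sigma_support lam : (forall j, finite_at [set j]%SET) ->
  (forall J : {set 'I_n}, J \proper [set: 'I_n]%SET -> finite_at J -> 0 <= lam J) ->
  exists2 v, Sigma_support h v & trop_embed v = generator_comb h lam.
Proof.
move=> h1 lam0; pose v : 'rV[R]_n := \row_j fine (generator_comb h lam 0 j).
have attained j : exists J : {set 'I_n},
    [/\ J \proper [set: 'I_n]%SET, finite_at J, j \notin J, finite_at (j |: J) &
    generator_comb h lam 0 j = (lam J + (fine (h (j |: J)) - fine (h J)))%:E].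
  pose P J := (J \proper [set: 'I_n]%SET) && finite_at J.
  (* The generator of the empty set has only finite entries, so the combination is a real vector. *)
  have P0 : P finset.set0.
    rewrite /P finite_set0 andbT; apply/properP.
    by split; [exact: finset.sub0set|exists j; rewrite ?finset.in_setT ?finset.in_set0].
  have lt_y : (generator_comb h lam 0%R j < +oo)%E.
    rewrite generator_combE; apply: (@le_lt_trans _ _ _ _ _ (bigmin_le_cond _ _ P0)).
    by rewrite generator_out ?finite_set0 ?finset.in_set0 // finset.setU0 h1 ltry.
  have [J /andP[JT hJ] JE] := @eq_bigmin _ _ _ +oo%E finset.set0 P
    (fun J => (lam J)%:E + generator h J 0%R j)%E P0 (fun J _ => leey _).
  exists J; move: lt_y; rewrite generator_combE JE.
  have [jJ|jJ] := boolP (j \in J); first by rewrite generator_in.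
  by rewrite generator_out //; case: ifP.
have vE j : (v 0 j)%:E = generator_comb h lam 0 j.
  by rewrite mxE; have [J [_ _ _ _ ->]] := attained j.
exists v; last by apply/rowP => j; rewrite mxE vE.
apply/Sigma_supportP => j; have [J [JT hJ jJ hjJ]] := attained j.
rewrite -vE => -[vj].
(* At the minimizing [J] the gain of [j] is exactly [lam J], while the minimum bounds the gain of
   every other [k] by [lam J]. *)
have lamJ : weight v (j |: J) - weight v J = lam J by rewrite weightU1 // vj; lra.
apply: (maximizer_containing jJ hJ hjJ) => [|k kJ hkJ].
  by rewrite -subr_ge0 lamJ lam0.
suff : weight v (k |: J) - weight v J <= lam J by rewrite -lamJ; lra.
rewrite weightU1 //; suff : ((v 0%R k)%:E <= (lam J + (fine (h (k |: J)) - fine (h J)))%:E)%E.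
  by rewrite lee_fin; lra.
rewrite vE generator_combE.
have := @bigmin_le_cond _ _ _ +oo%E J (fun J => (J \proper [set: 'I_n]%SET) && finite_at J)
  (fun J => (lam J)%:E + generator h J 0%R k)%E.
by rewrite JT hJ => /(_ isT); rewrite /= generator_out // hkJ.
Qed.

End Exchange.

(** * Application to lattices *)

Lemma entropy_set1 (R : realType) r n (A : 'M[puiseux R[i]]_(r, n)) a j :
  A a j != 0 -> entropy A [set j]%SET != +oo%E.
Proof.
move=> Aaj.
(* Column [j] in place of the unit vector at [a] gives determinant [A a j]. *)
pose s : 'I_r -> 'I_r + 'I_n := [eta inl with a |-> inr j].
have s_cols : selected_cols s = [set j]%SET.
  apply/setP => k; rewrite !inE codom_update => [|? ? [] //].
  suff /negPf-> : inr k \notin codom (@inl 'I_r 'I_n) by rewrite andbF orbF.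
  by apply/codomP => -[].
have : (entropy A [set j]%SET <= puiseux_val (A a j))%E.
  rewrite -s_cols; have := entropy_le_row_det A s.
  rewrite row_det_replace (_ : \matrix_i _ = 1%:M); last first.
    by apply/matrixP => p q; rewrite !mxE eqxx eq_sym.
  by rewrite -[\adj _]mul1mx mul_mx_adj det1 mulmx1 !mxE.
by apply: contraTneq => ->; rewrite leye_eq puiseux_val_eqy.
Qed.

(** A zero column of [A] would put the span in a coordinate hyperplane. *)
Lemma lattice_column_neq0 (R : realType) r n (L : set 'rV[puiseux R[i]]_n)
    (A : 'M[puiseux R[i]]_(r, n)) j :
  lattice_basis A L -> ~ (K_span L `<=` coord_hyperplane j) ->
  exists a, A a j != 0.
Proof.
move=> [_ ->] Lj; apply: contrapT => Aj; apply: Lj => _ [m [c [y [yL ->]]]].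
rewrite /coord_hyperplane /= summxE big1 // => i _; rewrite mxE.
have [b [_ ->]] := yL i; rewrite mxE big1 ?mulr0 // => a _.
have [->|Aaj] := eqVneq (A a j) 0; first by rewrite mulr0.
by case: Aj; exists a.
Qed.

Theorem theorem1p10 (R : realType) (r n : nat)
    (L : set 'rV[puiseux R[i]]_n) (A : 'M[puiseux R[i]]_(r, n))
    (LA : lattice_basis A L)
    (Lspan : forall j : 'I_n, ~ (K_span L `<=` coord_hyperplane j)) :
  let h : {set 'I_n} -> \bar R := entropy A in
  let S : set 'rV[\bar R]_n := [set trop_embed v | v in Sigma_support h] in
  (forall (u v : 'rV[\bar R]_n) (lam : R), S u -> S v -> 0 <= lam ->
     S (trop_scale lam u) /\ S (trop_add u v)) /\
  S = [set w | exists lam : {set 'I_n} -> R,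
         (forall J : {set 'I_n},
            J \proper [set: 'I_n]%SET -> h J != +oo%E -> 0 <= lam J) /\
         w = generator_comb h lam].
Proof.
move=> h S.
have h0 : h finset.set0 = 0%E := entropy0 A.
have hNy : forall J, h J != -oo%E := entropy_neqNy A.
have hex : exchange_property h := @entropy_exchange _ _ _ A.
have h1 j : finite_at h [set j]%SET.
  by have [a] := lattice_column_neq0 LA (@Lspan j); apply: entropy_set1.
have comb_S lam : (forall J : {set 'I_n},
    J \proper [set: 'I_n]%SET -> h J != +oo%E -> 0 <= lam J) ->
    S (generator_comb h lam).
  by case/(comb_Sigma_support h0 hNy hex h1) => v; exists v.
have S_comb w : S w -> exists lam, (forall J, 0 <= lam J) /\ w = generator_comb h lam.
  by case=> v /(Sigma_support_comb h0 hNy hex) H <-.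
split=> [_ _ c /S_comb[lam [lam0 ->]] /S_comb[mu [mu0 ->]] c0|].
  rewrite trop_scale_comb trop_add_comb; split; apply: comb_S => J _ _.
    by rewrite addr_ge0.
  by rewrite le_min lam0 mu0.
apply/seteqP; split=> [w /S_comb[lam [lam0 ->]]|_ [lam [lam0 ->]]].
  by exists lam; split.
exact: comb_S.
Qed.
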